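(* Let $X,Y$ be normed spaces, let $\varphi:X\times Y\to(-\infty,\infty]$ and $G:X\rightrightarrows Y$, and let $\mu(x)=\inf\{\varphi(x,y)\mid y\in G(x)\}$ and $M(x)=\{y\in G(x)\mid\varphi(x,y)=\mu(x)\}$. Let $\bar y\in M(\bar x)$, where $\mu$ is finite at $\bar x$. The following hold. (i) If $\varphi$ is calm at $(\bar x,\bar y)$, then $$\widehat\partial^{\infty}\mu(\bar x)\subset\widehat D^*G(\bar x,\bar y)(0).$$ (ii) We have $$\widehat\partial^{\infty}\mu(\bar x)\supset\bigcup_{(x^*,y^* )\in\widehat\partial^{\infty}\varphi(\bar x,\bar y)}\big[x^*+\widehat D^*G(\bar x,\bar y)(y^* )\big]$$ if at least one of the following conditions is fulfilled: (a) $G$ is semilocally nearly-isolated calm at $(\bar x,\bar y)$. (b) $G$ is locally nearly-isolated calm at $(\bar x,\bar y)$, and for every $\varepsilon>0$ there exists $\gamma>0$ such that $$\mu(x)=\inf_{y\in G(x)}\varphi(x,y)=\inf_{y\in G(x)\cap\mathbb B(\bar y,\varepsilon)}\varphi(x,y)\quad\text{for all }x\in\mathbb B(\bar x,\gamma).$$ (c) The solution mapping $M:\operatorname{dom}G\rightrightarrows Y$ admits an upper Lipschitzian selection at $(\bar x,\bar y)$.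
   Context: All spaces are normed; $X^*$ is the topological dual of $X$; $\mathbb B(\bar x,r)$ is the open ball, $\overline{\mathbb B}_Y$ is the closed unit ball of $Y$; product spaces carry the sum norm, e.g. $\|(x,y)\|=\|x\|+\|y\|$. For $F:X\rightrightarrows Y$, $\operatorname{dom}F=\{x\mid F(x)\neq\emptyset\}$ and $\operatorname{gph}F=\{(x,y)\mid y\in F(x)\}$; for an extended-real-valued $f$ on $Z$, $\operatorname{epi}f=\{(z,\alpha)\in Z\times\mathbb R\mid\alpha\ge f(z)\}$. The infimum over the empty set is $+\infty$. Regular normal cone: for $S\subset Z$ and $\bar z\in S$, $\widehat N(\bar z;S)=\{z^*\in Z^*\mid \limsup_{z\to\bar z,\,z\in S}\langle z^*,\frac{z-\bar z}{\|z-\bar z\|}\rangle\le0\}$. Singular regular subdifferential: for $f$ finite at $\bar z$, $\widehat\partial^{\infty}f(\bar z)=\{z^*\in Z^*\mid(z^*,0)\in\widehat N((\bar z,f(\bar z));\operatorname{epi}f)\}$. Regular coderivative: for $(\bar x,\bar y)\in\operatorname{gph}G$ and $y^*\in Y^*$, $\widehat D^*G(\bar x,\bar y)(y^* )=\{x^*\in X^*\mid (x^*,-y^* )\in\widehat N((\bar x,\bar y);\operatorname{gph}G)\}$. Calmness: a mapping $h:D\subset Z\to W$ is calm at $\bar z\in D$ if there are $r>0$, $\ell\ge0$ with $\|h(z)-h(\bar z)\|\le\ell\|z-\bar z\|$ for all $z\in\mathbb B(\bar z,r)\cap D$. For the extended-real-valued $\varphi$ this is understood with $D=X\times Y$, so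 $\varphi$ is finite on a neighborhood of $(\bar x,\bar y)$ and satisfies the inequality there. Nearly-isolated calmness at $(\bar x,\bar y)\in\operatorname{gph}F$: $F:X\rightrightarrows Y$ is locally nearly-isolated calm if there are $L>0$, $\gamma>0$ with $F(u)\cap\mathbb B(\bar y,\gamma)\subset\{\bar y\}+L\|u-\bar x\|\overline{\mathbb B}_Y$ for all $u\in\mathbb B(\bar x,\gamma)\setminus\{\bar x\}$; it is semilocally nearly-isolated calm if there are $L>0$, $\gamma>0$ with $F(u)\subset\{\bar y\}+L\|u-\bar x\|\overline{\mathbb B}_Y$ for all $u\in\mathbb B(\bar x,\gamma)\setminus\{\bar x\}$. Upper Lipschitzian selection: $F:D\rightrightarrows Y$, $D\subset X$, admits an upper Lipschitzian selection at $(\bar x,\bar y)\in\operatorname{gph}F$ if there is a single-valued $h:D\to Y$, calm at $\bar x$, with $h(\bar x)=\bar y$ and $h(x)\in F(x)$ for all $x\in D$ in a neighborhood of $\bar x$. *)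

(* Defs.v *)
From HB Require Import structures.
From mathcomp Require Import all_boot all_order all_algebra.
From mathcomp Require Import all_classical all_reals all_analysis.

Set Implicit Arguments.
Unset Strict Implicit.
Unset Printing Implicit Defensive.

Import Order.TTheory GRing.Theory Num.Theory.
Import numFieldNormedType.Exports.

Local Open Scope classical_set_scope.
Local Open Scope ring_scope.

(* The library norms X * Y with the maximum norm; this alias of X * Y carries
   the sum norm instead, together with the topology that norm induces. *)
Definition sum_prod (X Y : Type) : Type := (X * Y)%type.

Section SumProd.
Context {R : realType} (X Y : normedModType R).

HB.instance Definition _ := GRing.Lmodule.copy (sum_prod X Y) (X * Y)%type.

Definition sum_norm (z : sum_prod X Y) : R := `|z.1| + `|z.2|.

Lemma sum_norm_triangle (z w : sum_prod X Y) :
  sum_norm (z + w) <= sum_norm z + sum_norm w.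
Proof. by rewrite /sum_norm addrACA lerD// ler_normD. Qed.

Lemma sum_normZ (a : R) (z : sum_prod X Y) :
  sum_norm (a *: z) = `|a| * sum_norm z.
Proof. by rewrite /sum_norm !normrZ mulrDr. Qed.

Lemma sum_norm_eq0 (z : sum_prod X Y) : sum_norm z = 0 -> z = 0.
Proof.
case: z => x y /eqP; rewrite /sum_norm paddr_eq0// !normr_eq0 /=.
by move=> /andP[/eqP-> /eqP->].
Qed.

HB.instance Definition _ := Lmodule_isNormed.Build R (sum_prod X Y)
  sum_norm_triangle sum_normZ sum_norm_eq0.

End SumProd.

Section Duality.
Context {R : realType}.

Definition topdual (Z : normedModType R) : set (Z -> R) :=
  [set zs : Z -> R | scalar zs /\ continuous zs].

(* The functional on X x Y denoted by a pair (x^*, y^* ); Y := R^o gives the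
   elements (z^*, 0) of the dual of Z x R. *)
Definition dual_pair (X Y : normedModType R) (xs : X -> R) (ys : Y -> R) :
  sum_prod X Y -> R := fun z => xs z.1 + ys z.2.

End Duality.

Section Mappings.
Context {R : realType}.
Implicit Types X Y Z W : normedModType R.

Definition dom X Y (F : X -> set Y) : set X := [set x | F x !=set0].

Definition gph X Y (F : X -> set Y) : set (sum_prod X Y) :=
  [set z | F z.1 z.2].

Definition epi Z (f : Z -> \bar R) : set (sum_prod Z R^o) :=
  [set za | (f za.1 <= (za.2)%:E)%E].

Definition regular_normal_cone Z (S : set Z) (zbar : Z) : set (Z -> R) :=
  [set zs : Z -> R | topdual zs /\
    (limf_esup (fun z => (zs (`|z - zbar|^-1 *: (z - zbar)))%:E)
       (within S zbar^') <= 0)%E].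

(* Only meant for f finite at zbar. *)
Definition singular_subdiff Z (f : Z -> \bar R) (zbar : Z) : set (Z -> R) :=
  [set zs : Z -> R | topdual zs /\
    regular_normal_cone (epi f) (zbar, fine (f zbar)) (dual_pair zs 0)].

Definition regular_coderivative X Y (G : X -> set Y) (xbar : X) (ybar : Y)
    (ys : Y -> R) : set (X -> R) :=
  [set xs : X -> R | topdual xs /\
    regular_normal_cone (gph G) (xbar, ybar) (dual_pair xs (- ys))].

(* A map h : D -> W is given by any extension of it to Z; the values outside
   D are never used. *)
Definition calm_on Z W (D : set Z) (h : Z -> W) (zbar : Z) : Prop :=
  exists r l : R, [/\ 0 < r, 0 <= l &
    forall z, ball zbar r z -> D z -> `|h z - h zbar| <= l * `|z - zbar|].

Definition ereal_calm Z (f : Z -> \bar R) (zbar : Z) : Prop :=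
  (\forall z \near zbar, f z \is a fin_num) /\
  calm_on setT (fine \o f : Z -> R^o) zbar.

Definition closed_unit_ball Y : set Y := [set y | `|y| <= 1].

Definition locally_nearly_isolated_calm X Y (F : X -> set Y)
    (xbar : X) (ybar : Y) : Prop :=
  exists L gamma : R, [/\ 0 < L, 0 < gamma &
    forall u, ball xbar gamma u -> u <> xbar ->
      F u `&` ball ybar gamma `<=`
      [set ybar + (L * `|u - xbar|) *: b | b in @closed_unit_ball Y]].

Definition semilocally_nearly_isolated_calm X Y (F : X -> set Y)
    (xbar : X) (ybar : Y) : Prop :=
  exists L gamma : R, [/\ 0 < L, 0 < gamma &
    forall u, ball xbar gamma u -> u <> xbar ->
      F u `<=` [set ybar + (L * `|u - xbar|) *: b | b in @closed_unit_ball Y]].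

Definition upper_lipschitzian_selection X Y (D : set X) (F : X -> set Y)
    (xbar : X) (ybar : Y) : Prop :=
  exists h : X -> Y, [/\ calm_on D h xbar, h xbar = ybar &
    \forall x \near xbar, D x -> F x (h x)].

(* The library's ereal_inf of the empty set is +oo. *)
Definition marginal X Y (phi : sum_prod X Y -> \bar R) (G : X -> set Y)
    (x : X) : \bar R :=
  ereal_inf [set phi (x, y) | y in G x].

Definition solution_map X Y (phi : sum_prod X Y -> \bar R) (G : X -> set Y)
    (x : X) : set Y :=
  [set y | G x y /\ phi (x, y) = marginal phi G x].

End Mappings.

(* Main.v *)
(* In (i), calmness of phi turns a point (x, y) of gph G into a point
   (x, phi (xbar, ybar) + l * |(x, y) - (xbar, ybar)|) of epi mu at comparable
   distance.  In (ii), each of (a), (b), (c) turns a point (x, al) of epi mu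
   into y in G x with |y - ybar| <= L |x - xbar| and phi (x, y) <= al + |x - xbar|;
   adding the normal inequalities for epi phi at (x, y, al + |x - xbar|) and for
   gph G at (x, y) cancels y^*. *)

Require Import Defs.
From mathcomp Require Import all_boot all_order all_algebra.
From mathcomp Require Import all_classical all_reals all_analysis.
From mathcomp Require Import lra.
Import Order.TTheory GRing.Theory Num.Theory.
Import numFieldNormedType.Exports.
Local Open Scope classical_set_scope.
Local Open Scope ring_scope.

(** * Epsilon-delta forms of regular normals, singular subgradients and coderivatives *)

Lemma scalar_linearity {R : realType} {Z : normedModType R} (zs : Z -> R) :
  scalar zs -> [/\ forall z w, zs (z + w) = zs z + zs w, zs 0 = 0 &
    forall a z, zs (a *: z) = a * zs z].
Proof.
move=> szs.
have zsD z w : zs (z + w) = zs z + zs w by rewrite -[z in LHS]scale1r szs mul1r.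
have zs0 : zs 0 = 0 by apply: (addrI (zs 0)); rewrite -zsD !addr0.
by split=> // a z; rewrite -[a *: z]addr0 szs zs0 addr0.
Qed.

(** Homogeneity of [zs] clears the denominator [|z - zbar|]; the resulting inequality is trivial at
    [z = zbar], so the punctured neighborhood disappears. *)
Lemma regular_normal_coneP {R : realType} {Z : normedModType R} (S : set Z)
    (zbar : Z) (zs : Z -> R) :
  regular_normal_cone S zbar zs <->
  topdual zs /\ forall e, 0 < e -> exists2 d, 0 < d &
    forall z, S z -> `|z - zbar| < d -> zs (z - zbar) <= e * `|z - zbar|.
Proof.
split=> -[zsd H]; split=> //; have [szs _] := zsd.
all: have [_ zs0 zsZ] := scalar_linearity _ szs.
- move=> e e0.
  (* The upper limit is an infimum of suprema over members of the filter, so a value below [e] gives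
     one member [V] whose supremum is below [e]. *)
  have /ereal_inf_lt[_ [V FV <-] supV] : (limf_esup
      (fun z => (zs (`|z - zbar|^-1 *: (z - zbar)))%:E)
      (within S zbar^') < e%:E)%E by apply: (le_lt_trans H); rewrite lte_fin.
  have /nbhs_normP[d /= d0 dV] : \forall z \near zbar, z != zbar -> S z -> V z.
    exact: FV.
  exists d => // z Sz zd; have [->|zzbar] := eqVneq z zbar.
    by rewrite subrr zs0 normr0 mulr0.
  have Vz : V z by apply: dV => //=; rewrite distrC.
  have z0 : 0 < `|z - zbar| by rewrite normr_gt0 subr_eq0.
  have : ((zs (`|z - zbar|^-1 *: (z - zbar)))%:E < e%:E)%E.
    by apply: le_lt_trans supV; apply: ereal_sup_ubound; exists z.
  by rewrite lte_fin zsZ mulrC ltr_pdivrMr// => /ltW.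
- apply/lee_addgt0Pr => e e0; rewrite add0e.
  have [d d0 dP] := H _ e0.
  pose V := [set z | [/\ S z, `|z - zbar| < d & z != zbar]].
  apply: (@le_trans _ _ (ereal_sup
      ((fun z => (zs (`|z - zbar|^-1 *: (z - zbar)))%:E) @` V))).
    apply: ereal_inf_lbound; exists V => //.
    apply/nbhs_normP; exists d => //= z zd zzbar Sz; split => //.
    by rewrite distrC.
  apply: ge_ereal_sup => _ [z [Sz zd zzbar] <-].
  by rewrite lee_fin zsZ mulrC ler_pdivrMr ?normr_gt0 ?subr_eq0// dP.
Qed.

Lemma topdual_dual_pair {R : realType} {X Y : normedModType R} (xs : X -> R)
    (ys : Y -> R) : topdual xs -> topdual ys -> topdual (dual_pair xs ys).
Proof.
move=> [sxs cxs] [sys cys]; split.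
  by move=> a z w; rewrite /dual_pair /= sxs sys /= mulrDr addrACA.
move=> z.
(* The topology here is that of the sum norm; each projection is 1-Lipschitz for it. *)
have fst_c : continuous (fun w : sum_prod X Y => w.1).
  move=> w; have Fw := @nbhs_filter (sum_prod X Y) w.
  apply/(cvgrPdist_lt (FF := Fw)) => e e0; apply/nbhs_normP.
  by exists e => //= v; apply: le_lt_trans; rewrite lerDl.
have snd_c : continuous (fun w : sum_prod X Y => w.2).
  move=> w; have Fw := @nbhs_filter (sum_prod X Y) w.
  apply/(cvgrPdist_lt (FF := Fw)) => e e0; apply/nbhs_normP.
  by exists e => //= v; apply: le_lt_trans; rewrite lerDr.
have xs_c : continuous ((xs : X -> R^o) \o (fun w : sum_prod X Y => w.1)).
  by move=> w; apply: (continuous_comp (fst_c w)); exact: cxs.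
have ys_c : continuous ((ys : Y -> R^o) \o (fun w : sum_prod X Y => w.2)).
  by move=> w; apply: (continuous_comp (snd_c w)); exact: cys.
exact: (cvgD (xs_c z) (ys_c z)).
Qed.

Lemma topdualD {R : realType} {X : normedModType R} (f g : X -> R) :
  topdual f -> topdual g -> topdual (f + g).
Proof.
move=> [sf cf] [sg cg]; split.
  by move=> a z w; rewrite /= !fctE sf sg /= mulrDr addrACA.
by move=> z; apply: (@cvgD _ R^o); [exact: cf|exact: cg].
Qed.

Lemma topdual0 {R : realType} {X : normedModType R} : topdual (0 : X -> R).
Proof.
split.
  by move=> a z w; rewrite -[LHS]/(0 : R) -[RHS]/(a * 0 + 0 : R) mulr0 addr0.
by move=> z; apply: (@cvg_cst R^o).
Qed.

Lemma topdualN {R : realType} {X : normedModType R} (f : X -> R) :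
  topdual f -> topdual (- f).
Proof.
move=> [sf cf]; split.
  by move=> a z w; rewrite /= !fctE sf /= opprD mulrN.
by move=> z; apply: (@cvgN _ R^o); exact: cf.
Qed.

(** The zero second component removes [al] from the pairing, while [al] still counts in the distance
    on the right. *)
Lemma singular_subdiffP {R : realType} {Z : normedModType R}
    (f : Z -> \bar R) (zbar : Z) (zs : Z -> R) :
  singular_subdiff f zbar zs <->
  topdual zs /\ forall e, 0 < e -> exists2 d, 0 < d & forall z al,
    (f z <= al%:E)%E -> `|z - zbar| + `|al - fine (f zbar)| < d ->
    zs (z - zbar) <= e * (`|z - zbar| + `|al - fine (f zbar)|).
Proof.
have dualE z al : dual_pair zs (0 : R^o -> R)
    (((z, al) : sum_prod Z R^o) - (zbar, fine (f zbar))) = zs (z - zbar).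
  by rewrite /dual_pair /= addr0.
split=> -[zsd].
  move=> /regular_normal_coneP[_ N]; split=> // e /N[d d0 dN].
  by exists d => // z al fz zd; rewrite -(dualE z al); exact: (dN (z, al)).
move=> N; split=> //; apply/regular_normal_coneP; split.
  exact: topdual_dual_pair zsd topdual0.
move=> e /N[d d0 dN]; exists d => // -[z al] fz zd.
by rewrite dualE; exact: dN.
Qed.

Lemma regular_coderivativeP {R : realType} {X Y : normedModType R}
    (G : X -> set Y) (xbar : X) (ybar : Y) (ys : Y -> R) (xs : X -> R) :
  topdual ys ->
  regular_coderivative G xbar ybar ys xs <->
  topdual xs /\ forall e, 0 < e -> exists2 d, 0 < d & forall x y,
    G x y -> `|x - xbar| + `|y - ybar| < d ->
    xs (x - xbar) - ys (y - ybar) <= e * (`|x - xbar| + `|y - ybar|).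
Proof.
move=> ysd; split=> -[xsd].
  move=> /regular_normal_coneP[_ N]; split=> // e /N[d d0 dN].
  by exists d => // x y Gxy xyd; exact: (dN (x, y)).
move=> N; split=> //; apply/regular_normal_coneP; split.
  exact: topdual_dual_pair xsd (topdualN _ ysd).
by move=> e /N[d d0 dN]; exists d => // -[x y] Gxy xyd; exact: dN.
Qed.

(** * Singular subgradients of the marginal function *)

Section Marginal.
Context {R : realType} {X Y : normedModType R}.
Implicit Types (phi : sum_prod X Y -> \bar R) (G : X -> set Y).

Lemma marginal_le phi G x y : G x y -> (marginal phi G x <= phi (x, y))%E.
Proof. by move=> Gxy; apply: ereal_inf_lbound; exists y. Qed.

Lemma singular_subdiff_marginal_sub phi G (xbar : X) (ybar : Y) :
  solution_map phi G xbar ybar -> ereal_calm phi (xbar, ybar) ->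
  singular_subdiff (marginal phi G) xbar
    `<=` regular_coderivative G xbar ybar 0.
Proof.
move=> [_ phi_mu] [/nbhs_normP[r1 /= r10 phi_fin] [r [l [r0 l0 calm]]]].
move=> xs /singular_subdiffP[xsd N].
apply/(regular_coderivativeP _ _ _ _ _ topdual0); split=> // e e0.
have l10 : 0 < 1 + l by lra.
have [d d0 dN] := N (e / (1 + l)) (divr_gt0 e0 l10).
(* [r1] keeps [phi] finite, [r] gives the calmness estimate, and the last term brings the epigraph
   point, at distance at most [(1 + l) * n], within [d]. *)
exists (Num.min (Num.min r1 r) (d / (1 + l))).
  by rewrite !lt_min r10 r0 divr_gt0.
move=> x y Gxy; rewrite !lt_min => /andP[/andP[xyr1 xyr] xyd].
have phixy : phi (x, y) \is a fin_num.
  by apply: phi_fin; rewrite /ball_ /= distrC.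
have : `|fine (phi (x, y)) - fine (phi (xbar, ybar))|
    <= l * (`|x - xbar| + `|y - ybar|).
  by apply: (calm (x, y)) => //; rewrite -ball_normE /ball_ /= distrC.
rewrite phi_mu.
move: xyd; set n := `|_| + `|y - _|; set mu := fine (marginal _ _ _).
move=> nd calm_xy.
have n0 : 0 <= n by rewrite addr_ge0.
have alphaE : `|mu + l * n - mu| = l * n.
  by rewrite addrAC subrr add0r ger0_norm// mulr_ge0.
have bound : `|x - xbar| + `|mu + l * n - mu| <= (1 + l) * n.
  by rewrite alphaE mulrDl mul1r lerD2r lerDl.
rewrite subr0; apply: le_trans (dN x (mu + l * n) _ _) _.
(* The point lies in the epigraph because the marginal value at [x] is at most [phi (x, y)], which
   calmness bounds by [mu + l * n]. *)
- apply: le_trans (marginal_le _ _ _ _ Gxy) _.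
  rewrite -(fineK phixy) lee_fin -lerBlDl.
  exact: le_trans (ler_norm _) calm_xy.
- by apply: le_lt_trans bound _; rewrite mulrC -ltr_pdivlMr.
- apply: le_trans (ler_wpM2l _ bound) _; first by rewrite divr_ge0// ltW.
  by rewrite mulrA divfK// gt_eqF.
Qed.

(* The slack |x - xbar| replaces attainment of the infimum; being of first
   order, it is absorbed by e * |x - xbar| in the definition of normals. *)
Definition calm_near_solutions phi G (xbar : X) (ybar : Y) : Prop :=
  exists L gamma : R, [/\ 0 <= L, 0 < gamma &
    forall x al, ball xbar gamma x -> x <> xbar ->
      (marginal phi G x <= al%:E)%E ->
      exists y, [/\ G x y, (phi (x, y) <= (al + `|x - xbar|)%:E)%E &
        `|y - ybar| <= L * `|x - xbar|]].

Lemma singular_subdiff_marginal_sup phi G (xbar : X) (ybar : Y)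
    (xs1 xs2 : X -> R) (ys : Y -> R) :
  solution_map phi G xbar ybar -> calm_near_solutions phi G xbar ybar ->
  topdual xs1 -> topdual ys ->
  singular_subdiff phi (xbar, ybar) (dual_pair xs1 ys) ->
  regular_coderivative G xbar ybar ys xs2 ->
  singular_subdiff (marginal phi G) xbar (xs1 + xs2).
Proof.
move=> [_ phi_mu] [L [g [L0 g0 near_sol]]] xs1d ysd /singular_subdiffP[_ N1].
move=> /(regular_coderivativeP _ _ _ _ _ ysd)[xs2d N2].
apply/singular_subdiffP; split; first exact: topdualD.
move=> e e0.
(* With [a], [b], [c], [t] as named below, [c <= L * a] and [t <= a + b] give
   [2 * a + 2 * c + t <= (2 * L + 3) * a + b], the sum of the two distances used. *)
pose k := 2 * L + 3; have k0 : 0 < k by rewrite /k; lra.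
have ek0 : 0 < e / k by rewrite divr_gt0.
have [d1 d10 dN1] := N1 _ ek0; have [d2 d20 dN2] := N2 _ ek0.
rewrite phi_mu in dN1.
exists (Num.min g (Num.min d1 d2 / k)).
  by rewrite lt_min g0 divr_gt0// lt_min d10 d20.
move=> x al mual; rewrite lt_min => /andP[xg].
rewrite ltr_pdivlMr// lt_min => /andP[xd1 xd2].
(* The near-solution property speaks only of [x <> xbar]; at [xbar] the left side vanishes. *)
have [->|/eqP xxbar] := eqVneq x xbar.
  rewrite subrr fctE; have [[sxs1 _] [sxs2 _]] := (xs1d, xs2d).
  have [_ -> _] := scalar_linearity _ sxs1.
  have [_ -> _] := scalar_linearity _ sxs2.
  by rewrite addr0 mulr_ge0// ltW.
set mu := fine (marginal phi G xbar) in xg xd1 xd2 dN1 *.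
have [] := near_sol x al _ xxbar mual.
  rewrite -ball_normE /ball_ /= distrC.
  by apply: le_lt_trans xg; rewrite lerDl.
move=> y [Gxy phixy yL].
have alt : `|al + `|x - xbar| - mu| <= `|al - mu| + `|x - xbar|.
  by rewrite addrAC (le_trans (ler_normD _ _))// normr_id.
have : `|x - xbar| + `|y - ybar| + `|al + `|x - xbar| - mu| < d1 ->
    xs1 (x - xbar) + ys (y - ybar) <=
    e / k * (`|x - xbar| + `|y - ybar| + `|al + `|x - xbar| - mu|).
  exact: (dN1 (x, y) _ phixy).
have := dN2 x y Gxy.
rewrite fctE.
move: xd1 xd2 yL alt.
move: (normr_ge0 (x - xbar)) (normr_ge0 (al - mu)).
set a := `|x - xbar|; set b := `|al - mu|; set c := `|y - ybar|.
set t := `|al + a - mu| => a0 b0 xd1 xd2 yL alt h2 h1.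
have La0 : 0 <= L * a by rewrite mulr_ge0.
have Lb0 : 0 <= L * b by rewrite mulr_ge0.
rewrite /k in xd1 xd2.
have /h2 {}h2 : a + c < d2 by nra.
have /h1 {}h1 : a + c + t < d1 by nra.
have sum_le : (a + c) + (a + c + t) <= k * (a + b) by rewrite /k; nra.
have : e / k * ((a + c) + (a + c + t)) <= e * (a + b).
  apply: le_trans (ler_wpM2l (ltW ek0) sum_le) _.
  by rewrite mulrA divfK// gt_eqF.
(* Adding [h1] and [h2] cancels [ys (y - ybar)]. *)
rewrite mulrDr; lra.
Qed.

Lemma dist_scaled_unit_ball (ybar y : Y) (c : R) : 0 <= c ->
  [set ybar + c *: b | b in @closed_unit_ball R Y] y -> `|y - ybar| <= c.
Proof.
move=> c0 [b b1 <-]; rewrite addrAC subrr add0r normrZ ger0_norm//.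
exact: ler_piMr.
Qed.

(** The calmness radius [g] serves as [eps] in the localized infimum, so the near-minimizers found
    lie in the ball where the calmness estimate applies. *)
Lemma calm_near_solutions_local phi G (xbar : X) (ybar : Y) :
  locally_nearly_isolated_calm G xbar ybar ->
  (forall eps : R, 0 < eps -> exists2 gamma : R, 0 < gamma &
    forall x, ball xbar gamma x ->
      marginal phi G x =
      ereal_inf [set phi (x, y) | y in G x `&` ball ybar eps]) ->
  calm_near_solutions phi G xbar ybar.
Proof.
move=> [L [g [L0 g0 FL]]] /(_ _ g0)[g' g'0 muE].
exists L, (Num.min g g'); split; [exact: ltW|by rewrite lt_min g0 g'0|].
move=> x al xg xxbar mual.
have xgg : ball xbar g x by apply: le_ball xg; rewrite ge_min lexx.
have xgg' : ball xbar g' x by apply: le_ball xg; rewrite ge_min lexx orbT.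
have x0 : 0 < `|x - xbar| by rewrite normr_gt0 subr_eq0; apply/eqP.
(* The slack is positive since [x <> xbar], and a strict bound on an infimum is met by some [y]. *)
have : (marginal phi G x < (al + `|x - xbar|)%:E)%E.
  by apply: (le_lt_trans mual); rewrite lte_fin ltrDl.
rewrite muE// => /ereal_inf_lt[_ [y [Gxy yg] <-] /ltW phixy].
exists y; split=> //; apply: dist_scaled_unit_ball.
  by rewrite mulr_ge0// ltW.
exact: FL.
Qed.

(** The estimate covers all of [G x], so any near-minimizer will do. *)
Lemma calm_near_solutions_semilocal phi G (xbar : X) (ybar : Y) :
  semilocally_nearly_isolated_calm G xbar ybar ->
  calm_near_solutions phi G xbar ybar.
Proof.
move=> [L [g [L0 g0 FL]]]; exists L, g; split=> //; first exact: ltW.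
move=> x al xg xxbar mual.
have x0 : 0 < `|x - xbar| by rewrite normr_gt0 subr_eq0; apply/eqP.
have /ereal_inf_lt[_ [y Gxy <-] /ltW phixy] :
    (marginal phi G x < (al + `|x - xbar|)%:E)%E.
  by apply: (le_lt_trans mual); rewrite lte_fin ltrDl.
exists y; split=> //; apply: dist_scaled_unit_ball.
  by rewrite mulr_ge0// ltW.
exact: FL.
Qed.

Lemma calm_near_solutions_selection phi G (xbar : X) (ybar : Y) :
  upper_lipschitzian_selection (dom G) (solution_map phi G) xbar ybar ->
  calm_near_solutions phi G xbar ybar.
Proof.
move=> [h [[r [l [r0 l0 calm_h]]] hybar /nbhs_ballP[g /= g0 hM]]].
exists l, (Num.min r g); split=> //; first by rewrite lt_min r0 g0.
move=> x al xr xxbar mual.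
(* A real upper bound [al] excludes the value [+oo] of the infimum over the empty set. *)
have Dx : dom G x.
  have : (marginal phi G x < +oo)%E by apply: (le_lt_trans mual); rewrite ltry.
  by move=> /ereal_inf_lt[_ [y Gxy _] _]; exists y.
(* The selection value [h x] is an exact minimizer, and calmness of [h] at [xbar] bounds its
   distance to [ybar]. *)
have [|Ghx phihx] := hM x _ Dx.
  by apply: le_ball xr; rewrite ge_min lexx orbT.
exists (h x); split=> //.
  by rewrite phihx; apply: (le_trans mual); rewrite lee_fin lerDl.
by rewrite -hybar; apply: calm_h => //; apply: le_ball xr; rewrite ge_min lexx.
Qed.

End Marginal.

Theorem theorem3p4 (R : realType) (X Y : normedModType R)
    (phi : sum_prod X Y -> \bar R) (G : X -> set Y) (xbar : X) (ybar : Y)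
    (phi_gtNy : forall z, phi z <> -oo%E)
    (mu_fin : marginal phi G xbar \is a fin_num)
    (ybar_sol : solution_map phi G xbar ybar) :
  (ereal_calm phi (xbar, ybar) ->
     singular_subdiff (marginal phi G) xbar
       `<=` regular_coderivative G xbar ybar 0)
  /\
  ((semilocally_nearly_isolated_calm G xbar ybar
    \/ (locally_nearly_isolated_calm G xbar ybar
        /\ forall eps : R, 0 < eps -> exists2 gamma : R, 0 < gamma &
             forall x, ball xbar gamma x ->
               marginal phi G x =
               ereal_inf [set phi (x, y) | y in G x `&` ball ybar eps])
    \/ upper_lipschitzian_selection (dom G) (solution_map phi G) xbar ybar) ->
   \bigcup_(p in [set p : (X -> R) * (Y -> R) |
                   [/\ topdual p.1, topdual p.2 &
                     singular_subdiff phi (xbar, ybar) (dual_pair p.1 p.2)]])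
     [set p.1 + xs | xs in regular_coderivative G xbar ybar p.2]
     `<=` singular_subdiff (marginal phi G) xbar).
Proof.
split=> [calm_phi|cond]; first exact: singular_subdiff_marginal_sub.
have near_sol : calm_near_solutions phi G xbar ybar.
  case: cond => [|[[]|]].
  - exact: calm_near_solutions_semilocal.
  - exact: calm_near_solutions_local.
  - exact: calm_near_solutions_selection.
move=> _ [[xs1 ys] /= [xs1d ysd phis] [xs2 Gxs2 <-]].
exact: singular_subdiff_marginal_sup near_sol _ _ phis Gxs2.
Qed.
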